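(* Exact identification of monotone threshold functions of $n$ variables, using membership and subcube identity queries, requires at least $\binom{n}{\lfloor n/2\rfloor}$ queries in the worst case.
   Context: A threshold function of $x_1,\ldots,x_n$ is a Boolean function $f$ such that for some reals $\alpha_0,\alpha_1,\ldots,\alpha_n$, $f(x)=1\iff \alpha_1x_1+\cdots+\alpha_nx_n\ge\alpha_0$; it is a monotone threshold function if such weights exist with $\alpha_1,\ldots,\alpha_n\ge0$. A partial assignment $p$ is a map $\{x_1,\ldots,x_n\}\to\{0,1,*\}$; the projection $f_p$ is the function of the variables $p^{-1}( * )$ obtained by fixing the others to their values under $p$. A membership query takes a total assignment $a$ and returns $f(a)$; a subcube identity query takes a partial assignment $p$ and returns ''yes'' iff $f_p\equiv0$ or $f_p\equiv1$. Exact identification: a deterministic algorithm, knowing the class and the variables, adaptively queries the unknown target and must determine it; the bound concerns the worst-case number of queries. *)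

(* Defs.v *)
From mathcomp Require Import all_boot all_order all_algebra.
From mathcomp Require Import reals.

Set Implicit Arguments.
Unset Strict Implicit.
Unset Printing Implicit Defensive.

Import Order.TTheory GRing.Theory Num.Theory.
Local Open Scope ring_scope.

Definition assignment (n : nat) := {ffun 'I_n -> bool}.

Definition boolfun (n : nat) := {ffun assignment n -> bool}.

Definition threshold_rep (R : realType) (n : nat) (alpha0 : R)
    (alpha : 'I_n -> R) (f : boolfun n) : Prop :=
  forall x : assignment n,
    f x <-> alpha0 <= \sum_(i < n) alpha i * (x i)%:R.

Definition monotone_threshold (R : realType) (n : nat) (f : boolfun n) : Prop :=
  exists (alpha0 : R) (alpha : 'I_n -> R),
    (forall i, 0 <= alpha i) /\ threshold_rep alpha0 alpha f.

(* [None] stands for the symbol *, and [Some b] for the fixed value b. *)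
Definition partial_assignment (n : nat) := {ffun 'I_n -> option bool}.

Definition free_var (n : nat) (p : partial_assignment n) :=
  {i : 'I_n | p i == None}.

(* [insub i] is [Some] of i seen as a free variable when [p i] is [None], and
   [None] otherwise; the default [false] of [odflt] is therefore never used. *)
Definition complete (n : nat) (p : partial_assignment n)
    (y : {ffun free_var p -> bool}) : assignment n :=
  [ffun i => if insub i is Some j then y j else odflt false (p i)].

Definition projection (n : nat) (f : boolfun n) (p : partial_assignment n) :
    {ffun {ffun free_var p -> bool} -> bool} :=
  [ffun y => f (complete y)].

Inductive query (n : nat) :=
  | Membership of assignment n
  | SubcubeIdentity of partial_assignment n.

Definition answer (n : nat) (f : boolfun n) (q : query n) : bool :=
  match q with
  | Membership a => f a
  | SubcubeIdentity p =>
      (projection f p == [ffun=> false]) || (projection f p == [ffun=> true])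
  end.

(* A deterministic adaptive algorithm for n known variables is a decision tree:
   it either stops and outputs a hypothesis, or asks a query and continues
   according to the answer. Internal computation is unrestricted. Trees are
   finite, which is no restriction for identifying a class of functions of n
   variables: the class is finite, so branches followed by no target in it can
   be cut off. *)
Inductive algorithm (n : nat) :=
  | Output of boolfun n
  | Ask of query n & (bool -> algorithm n).

Fixpoint output (n : nat) (A : algorithm n) (f : boolfun n) : boolfun n :=
  match A with
  | Output g => g
  | Ask q next => output (next (answer f q)) f
  end.

Fixpoint query_count (n : nat) (A : algorithm n) (f : boolfun n) : nat :=
  match A with
  | Output _ => 0%N
  | Ask q next => (query_count (next (answer f q)) f).+1
  end.

Definition exactly_identifies (n : nat) (C : boolfun n -> Prop)
    (A : algorithm n) : Prop :=
  forall f : boolfun n, C f -> output A f = f.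

(* Main.v *)
Require Import Defs.
From mathcomp Require Import all_boot all_order all_algebra.
From mathcomp Require Import reals.

(** Take the target f(x) = 1 iff |x| >= k with k = n/2. For each a of weight k
    the function f_a, obtained from f by changing its value at a to 0, is again
    a monotone threshold function, so every f_a must be told apart from f. One
    query tells at most one f_a apart from f: if a subcube contains two
    assignments a <> b of weight k, then it contains their meet, where f is 0,
    so that f is not constant on it; nor is f_a, which is 0 at a and 1 at b. *)

(** Adversary argument: along the branch followed by [f], each query removes at most one index from
    [S]. An index that survives to the leaf follows the same branch, hence gets the same output. *)
Lemma undistinguished (n : nat) (I : finType) (f : boolfun n)
    (g : I -> boolfun n) (A : algorithm n) (S : {set I}) :
  (forall q i j, answer (g i) q != answer f q ->
     answer (g j) q != answer f q -> i = j) ->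
  query_count A f < #|S| -> exists2 i, i \in S & output A (g i) = output A f.
Proof.
move=> one_per_query; elim: A S => [h | q next IH] S /=.
  by rewrite card_gt0 => /set0Pn [i Si]; exists i.
(* [D] holds the indices that leave the branch of [f] at this query. *)
move=> ltS; pose D := [set i | answer (g i) q != answer f q].
have leD : #|D| <= 1.
  by apply/card_le1_eqP => i j; rewrite !inE => Di Dj; exact: one_per_query Dj Di.
have [|i] := IH (answer f q) (S :\: D).
  rewrite -ltnS (leq_trans ltS) // -(cardsID D S) -add1n leq_add2r.
  by rewrite (leq_trans _ leD) // subset_leq_card ?subsetIr.
by rewrite !inE negbK => /andP [/eqP eq_ans Si] eq_out; exists i; rewrite ?eq_ans.
Qed.

Section Threshold.

Set Implicit Arguments.
Unset Strict Implicit.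

Variable n : nat.

Implicit Types (x y : assignment n) (p : partial_assignment n) (f : boolfun n).

Definition support x : {set 'I_n} := [set i | x i].

Lemma monotone_threshold_nat (R : realType) f (t : nat) (w : 'I_n -> nat) :
  (forall x, f x = (t <= \sum_(i in support x) w i)) -> monotone_threshold R f.
Proof.
move=> fE; exists t%:R%R, (fun i => (w i)%:R%R).
split=> [i | x]; first exact: Num.Theory.ler0n.
rewrite fE -(Num.Theory.ler_nat R) GRing.natr_sum big_mkcond.
suff -> : (\sum_i (if i \in support x then (w i)%:R else 0) =
  \sum_i (w i)%:R * (x i)%:R :> R)%R by [].
apply: eq_bigr => i _; rewrite inE.
by case: (x i); rewrite ?GRing.mulr1 ?GRing.mulr0.
Qed.

(** A test on total assignments, which keeps the dependent type [free_var p] out of the later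
    arguments. *)
Definition in_subcube p x : bool :=
  [forall i, (p i == None) || (p i == Some (x i))].

Lemma in_subcubeP p x :
  reflect (exists y : {ffun free_var p -> bool}, complete y = x) (in_subcube p x).
Proof.
apply: (iffP forallP) => [px | [y <-] i].
  exists [ffun j => x (val j)]; apply/ffunP => i; rewrite ffunE.
  case: insubP => [j _ <- | /negPf pi]; first by rewrite ffunE.
  by move: (px i); rewrite pi => /eqP ->.
rewrite ffunE; case: insubP => [j -> // | ].
by case: (p i) => //= b _; rewrite eqxx.
Qed.

Lemma projection_constP f p b :
  reflect (forall x, in_subcube p x -> f x = b) (projection f p == [ffun=> b]).
Proof.
apply: (iffP eqP) => [/ffunP fp x /in_subcubeP [y <-] | fp].
  by have := fp y; rewrite !ffunE.
by apply/ffunP => y; rewrite !ffunE; apply/fp/in_subcubeP; exists y.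
Qed.

Lemma answer_nonconstant f p x y :
  in_subcube p x -> in_subcube p y -> f x -> ~~ f y ->
  answer f (SubcubeIdentity p) = false.
Proof.
move=> px py fx /negPf fy; apply/negP => /orP [] /projection_constP fp.
  by rewrite fp in fx.
by rewrite fp in fy.
Qed.

Lemma eq_in_answer f f' p :
  (forall x, in_subcube p x -> f x = f' x) ->
  answer f (SubcubeIdentity p) = answer f' (SubcubeIdentity p).
Proof.
move=> ff'; rewrite /answer; suff -> : projection f p = projection f' p by [].
by apply/ffunP => y; rewrite !ffunE; apply/ff'/in_subcubeP; exists y.
Qed.

Definition meet x y : assignment n := [ffun i => x i && y i].

Lemma in_subcube_meet p x y :
  in_subcube p x -> in_subcube p y -> in_subcube p (meet x y).
Proof.
move=> /forallP px /forallP py; apply/forallP => i; move: (px i) (py i).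
by rewrite ffunE; case: (p i) => [[]|] //=; case: (x i); case: (y i).
Qed.

Lemma support_meet x y : support (meet x y) = support x :&: support y.
Proof. by apply/setP => i; rewrite !inE ffunE. Qed.

Variable k : nat.

Definition at_least : boolfun n := [ffun x => k <= #|support x|].

(** This is f_a, with a given by its support [S]. *)
Definition at_least_but (S : {set 'I_n}) : boolfun n :=
  [ffun x => (k <= #|support x|) && (support x != S)].

Lemma at_least_monotone (R : realType) : monotone_threshold R at_least.
Proof.
by apply: (@monotone_threshold_nat R _ k (fun=> 1)) => x; rewrite ffunE sum1_card.
Qed.

(* Weights n+1 on S and n+2 off S: the bonus |T \ S| <= n breaks ties within
   weight k, where it vanishes only for T = S, without reordering the levels. *)
Lemma at_least_but_monotone (R : realType) (S : {set 'I_n}) :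
  #|S| = k -> monotone_threshold R (at_least_but S).
Proof.
move=> cS.
(* The final [.+1] in the threshold asks for a positive bonus at level [k], which only [S] lacks. *)
apply: (@monotone_threshold_nat R _ (n.+1 * k).+1 (fun i => n.+1 + (i \notin S))).
move=> x; rewrite ffunE; set T := support x.
have -> : \sum_(i in T) (n.+1 + (i \notin S)) = n.+1 * #|T| + #|T :\: S|.
  rewrite big_split sum_nat_const mulnC; congr (_ + _).
  rewrite -sum1_card big_mkcond [RHS]big_mkcond /=; apply: eq_bigr => i _.
  by rewrite in_setD; case: (i \in T); case: (i \in S).
have leTS : #|T :\: S| <= n.
  by rewrite -[X in _ <= X]card_ord max_card.
case: (ltngtP k #|T|) => [ltkT | ltTk | eqkT] /=.
- have -> : T != S by apply: contraTneq ltkT => ->; rewrite cS ltnn.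
  apply/esym/ltn_addr; by rewrite ltn_pmul2l.
- apply/esym/negbTE; rewrite -leqNgt.
  apply: (@leq_trans (n.+1 * #|T|.+1)); last by rewrite leq_pmul2l.
  by rewrite mulnS addnC leq_add2r ltnW.
- rewrite -eqkT -addn1 leq_add2l card_gt0 setD_eq0.
  by rewrite eqEcard cS eqkT leqnn andbT.
Qed.

Lemma one_at_least_but_per_query (q : query n) (S T : {set 'I_n}) :
  #|S| = k -> #|T| = k ->
  answer (at_least_but S) q != answer at_least q ->
  answer (at_least_but T) q != answer at_least q -> S = T.
Proof.
case: q => [c | p] cS cT.
  rewrite /= !ffunE; case: (k <= _) => //=.
  by rewrite !eqb_id !negbK => /eqP <- /eqP.
pose ind (U : {set 'I_n}) : assignment n := [ffun i => i \in U].
have indK U : support (ind U) = U by apply/setP => i; rewrite inE ffunE.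
(* The two functions can differ only at [ind U], so a subcube that misses it gets equal answers. *)
have inP U : answer (at_least_but U) (SubcubeIdentity p) !=
    answer at_least (SubcubeIdentity p) -> in_subcube p (ind U).
  apply: contraR => pU; apply/eqP/eq_in_answer => x px; rewrite !ffunE.
  suff -> : support x != U by rewrite andbT.
  apply: contraNneq pU => <-; suff -> : ind (support x) = x by [].
  by apply/ffunP => i; rewrite ffunE inE.
move=> dS dT; have pS := inP _ dS; have pT := inP _ dT.
(* If [S] and [T] differ, both answers are [false], against [dS]. *)
apply/eqP; apply: contraNT dS => neST.
have -> : answer (at_least_but S) (SubcubeIdentity p) = false.
  apply: (answer_nonconstant pT pS); rewrite ffunE indK ?cT ?leqnn ?eqxx ?andbF //.
  by rewrite eq_sym.
suff -> : answer at_least (SubcubeIdentity p) = false by [].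
apply: (answer_nonconstant pS (in_subcube_meet pS pT)).
  by rewrite ffunE indK cS.
(* Distinct sets of equal size meet in a proper subset of each, so the meet has weight below [k]. *)
rewrite ffunE support_meet !indK -ltnNge -[X in _ < X]cS.
apply/proper_card; rewrite properEneq subsetIl andbT.
apply: contraNneq neST => /setIidPl sST.
by rewrite eqEcard sST cS cT leqnn.
Qed.

End Threshold.

Theorem theorem3 (R : realType) (n : nat) (A : algorithm n) :
  exactly_identifies (@monotone_threshold R n) A ->
  exists f : boolfun n,
    monotone_threshold R f /\ ('C(n, n./2) <= query_count A f)%N.
Proof.
set k := n./2 => idA; exists (at_least n k).
have monf := at_least_monotone n k R; split=> //.
rewrite leqNgt; apply/negP => few.
pose kset := {S : {set 'I_n} | #|S| == k}.
pose g (S : kset) : boolfun n := at_least_but k (val S).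
have one q (S T : kset) : answer (g S) q != answer (at_least n k) q ->
    answer (g T) q != answer (at_least n k) q -> S = T.
  move=> dS dT; apply/val_inj.
  exact: one_at_least_but_per_query (eqP (valP S)) (eqP (valP T)) dS dT.
have [|S _] := undistinguished _ _ _ _ A [set: kset] one.
  by rewrite cardsT card_sig -cardsE card_draws card_ord.
have cS := eqP (valP S).
rewrite !idA //; last exact: at_least_but_monotone.
(* Equal outputs would make [g S] and the target equal, but they differ at the indicator of [S]. *)
pose x : assignment n := [ffun i => i \in val S].
have xS : support x = val S by apply/setP => i; rewrite inE ffunE.
by move/ffunP/(_ x); rewrite !ffunE xS eqxx cS leqnn.
Qed.
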